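(* Let $\mathcal{H}$ be a real Hilbert space, $f:\mathcal{H}\to\mathbb{R}$ a convex function with $\operatorname{argmin} f\neq\emptyset$, $\tilde f:\mathcal{H}\times[0,\infty)\to\mathbb{R}$ a smoothing function of $f$ (in the sense of the context), $\alpha>0$, $t_0>0$, and let $\mu:[0,\infty)\to[0,\infty)$ be continuously differentiable and strictly decreasing with $\lim_{t\to\infty}\mu(t)=0$ and $\int_{t_0}^\infty t\mu(t)\,dt<\infty$. Let $x:[t_0,\infty)\to\mathcal{H}$ be a trajectory of $$\ddot x(t)+\frac{\alpha}{t}\dot x(t)+\nabla_x\tilde f(x(t),\mu(t))=0,\qquad t\ge t_0.$$ (i) If $\alpha\ge 3$, then $f(x(t))-\min f=O\left(\frac{1}{t^2}\right)$ as $t\to\infty$. (ii) If $\alpha>3$, then $$\int_{t_0}^\infty t\,\bigl(f(x(t))-\min f\bigr)\,dt<\infty,\qquad \int_{t_0}^\infty t\,\|\dot x(t)\|^2\,dt<\infty,$$ and $f(x(t))-\min f=o\left(\frac{1}{t^2}\right)$ as $t\to\infty$.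
   Context: A function $\tilde f:\mathcal{H}\times[0,\infty)\to\mathbb{R}$ is called a smoothing function of the convex function $f:\mathcal{H}\to\mathbb{R}$ if: (i) for each fixed $\mu>0$, $\tilde f(\cdot,\mu)$ is continuously differentiable on $\mathcal{H}$, and for each fixed $x\in\mathcal{H}$, $\tilde f(x,\cdot)$ is continuously differentiable on $(0,\infty)$; (ii) $\lim_{z\to x,\ \mu\downarrow 0}\tilde f(z,\mu)=f(x)$ for all $x\in\mathcal{H}$; (iii) $\tilde f(\cdot,\mu)$ is convex on $\mathcal{H}$ for each fixed $\mu>0$; (iv) there is a constant $\kappa>0$ with $|\nabla_\mu\tilde f(x,\mu)|\le\kappa$ for all $\mu\in(0,\infty)$, $x\in\mathcal{H}$; (v) there is a constant $L>0$ such that for every $\mu\in(0,\infty)$, $\nabla_x\tilde f(\cdot,\mu)$ is Lipschitz continuous on $\mathcal{H}$ with constant $L\mu^{-1}$; (vi) for each fixed $z\in\mathcal{H}$, $\mu\mapsto\nabla_z\tilde f(z,\mu)$ is continuous on $(0,\infty)$. Here $\nabla_x\tilde f$ and $\nabla_\mu\tilde f$ denote the gradient in the first variable and the derivative in the second variable. A trajectory is a twice continuously differentiable function $x:[t_0,\infty)\to\mathcal{H}$ satisfying the differential equation for all $t\ge t_0$ (one-sided derivatives at $t_0$). Since $\mu$ is strictly decreasing with limit $0$, one has $\mu(t)>0$ for all $t\geq 0$. *)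

(* Defs.v *)
From HB Require Import structures.
From mathcomp Require Import all_boot all_order all_algebra.
From mathcomp Require Import sesquilinear.
From mathcomp Require Import all_classical all_reals all_analysis.

Set Implicit Arguments.
Unset Strict Implicit.
Unset Printing Implicit Defensive.

Import Order.TTheory GRing.Theory Num.Theory.
Import numFieldNormedType.Exports.

Local Open Scope classical_set_scope.
Local Open Scope ring_scope.

(* Needed by the Landau notations [=O_+oo] and [=o_+oo]. *)
Canonical pinfty_filter_on (R : numFieldType) := FilterType (pinfty_nbhs R) _.

(* A real Hilbert space is a complete normed module [H] together with a
   positive definite symmetric bilinear form [ip : {dot H for idfun}]
   that induces its norm. *)
Definition inner_product_of_norm (R : realType) (H : normedModType R)
    (ip : {dot H for (@idfun R)}) : Prop :=
  forall u : H, ip u u = `|u| ^+ 2.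

(* Riesz representative of the Frechet differential; meaningful only where
   [f] is differentiable and [H] is a Hilbert space. *)
Definition grad (R : realType) (H : normedModType R)
    (ip : {dot H for (@idfun R)}) (f : H -> R) (x : H) : H :=
  get [set g : H | forall h : H, 'd f x h = ip g h].

Definition argmin (R : realType) (H : normedModType R) (f : H -> R) : set H :=
  [set z | forall y, f z <= f y].

(* The common value of [f] on [argmin f]; meaningful only if [argmin f] is
   nonempty. *)
Definition min_value (R : realType) (H : normedModType R) (f : H -> R) : R :=
  f (get (argmin f)).

(* The library's [derivable] and [derive1] are two-sided.  Here the difference
   quotient is taken along [A], so that derivatives at an endpoint of an
   interval [A] are one-sided and the values of [u] outside [A] are
   irrelevant. *)
Definition diff_quotient (R : realType) (V : normedModType R)
    (u : R -> V) (t s : R) : V :=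
  (s - t)^-1 *: (u s - u t).

Definition derivable_within (R : realType) (V : normedModType R)
    (A : set R) (u : R -> V) (t : R) : Prop :=
  cvg (diff_quotient u t s @[s --> within A t^']).

Definition derive_within (R : realType) (V : normedModType R)
    (A : set R) (u : R -> V) (t : R) : V :=
  lim (diff_quotient u t s @[s --> within A t^']).

Definition C1_within (R : realType) (V : normedModType R)
    (A : set R) (u : R -> V) : Prop :=
  (forall t, A t -> derivable_within A u t) /\
  {within A, continuous (derive_within A u)}.

(* Only the values of [ft] at nonnegative second arguments are relevant; its
   values at [0] are unconstrained. *)
Record smoothing_function (R : realType) (H : completeNormedModType R)
    (ip : {dot H for (@idfun R)}) (f : H -> R) (ft : H -> R -> R) : Prop := {
  smoothing_differentiable : forall mu : R, 0 < mu ->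
    forall x : H, differentiable (ft ^~ mu) x ;
  smoothing_grad_continuous : forall mu : R, 0 < mu ->
    continuous (grad ip (ft ^~ mu)) ;
  smoothing_derivable : forall (x : H) (mu : R), 0 < mu ->
    derivable (ft x) mu 1 ;
  smoothing_derive_continuous : forall x : H,
    {within `]0, +oo[, continuous (derive1 (ft x))} ;
  smoothing_limit : forall x : H,
    ft p.1 p.2 @[p --> filter_prod (nbhs x) 0^'+] --> f x ;
  smoothing_convex : forall mu : R, 0 < mu ->
    convex_function [set: convex_lmodType H] (ft ^~ mu) ;
  smoothing_derive_bounded : exists2 kappa : R, 0 < kappa &
    forall (x : H) (mu : R), 0 < mu -> `|(derive1 (ft x)) mu| <= kappa ;
  smoothing_grad_lipschitz : exists2 L : R, 0 < L &
    forall mu : R, 0 < mu -> (L * mu^-1).-lipschitz (grad ip (ft ^~ mu)) ;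
  smoothing_grad_continuous_mu : forall z : H,
    {within `]0, +oo[, continuous (fun mu : R => grad ip (ft ^~ mu) z)}
}.

Record trajectory (R : realType) (H : completeNormedModType R)
    (ip : {dot H for (@idfun R)}) (ft : H -> R -> R) (alpha t0 : R)
    (mu : R -> R) (x : R -> H) : Prop := {
  trajectory_C1 : C1_within `[t0, +oo[ x ;
  trajectory_C2 : C1_within `[t0, +oo[ (derive_within `[t0, +oo[ x) ;
  trajectory_ode : forall t : R, t0 <= t ->
    derive_within `[t0, +oo[ (derive_within `[t0, +oo[ x) t
      + (alpha / t) *: derive_within `[t0, +oo[ x t
      + grad ip (ft ^~ (mu t)) (x t) = 0
}.

(* Main.v *)
(* Write [g t = ft (x t) (mu t) + kappa * mu t - min f].  Since
   [|ft y m - f y| <= kappa * m], this dominates [f (x t) - min f >= 0].  With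
   [E_c t = t ^+ 2 * g t + |c (x t - x* ) + t x'(t)| ^+ 2 / 2], the equation and
   the gradient inequality at a minimiser [x*] give, for [c = alpha - 1] and
   [c = 0] respectively,
     [E_c' <= (3 - alpha) t g + 2 (alpha - 1) kappa t mu] and
     [E_0' <= 2 t g - (alpha - 1) t |x'| ^+ 2].
   The first bounds [t ^+ 2 * g] and, if [alpha > 3], the integral of [t g]; the
   second then bounds the integral of [t |x'| ^+ 2].  Consequently
   [E_0 t / t = t g + t |x'| ^+ 2 / 2] is integrable, so [E_0] is small at
   arbitrarily large times, and it cannot grow back because the positive part
   of [E_0'] is at most the integrable function [2 t g].

   Joint differentiability of [ft] is never used: convexity in the first
   variable and monotonicity of [m |-> ft y m + kappa * m] bound the right
   difference quotients of [g] directly, and the equation itself makes the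
   gradient along the trajectory continuous.  Monotonicity is obtained from such
   upper bounds on right difference quotients, which also treats the endpoint
   [t0] like any other time. *)
Require Import Defs.
From HB Require Import structures.
From mathcomp Require Import all_boot all_order all_algebra.
From mathcomp Require Import sesquilinear.
From mathcomp Require Import all_classical all_reals all_analysis.
From mathcomp Require Import measurable_realfun ring lra.

Import Order.TTheory GRing.Theory Num.Theory.
Import numFieldNormedType.Exports.

Local Open Scope classical_set_scope.
Local Open Scope ring_scope.

Set Implicit Arguments.
Unset Strict Implicit.
Unset Printing Implicit Defensive.

(** * Inner products and the Riesz representation theorem *)

Section InnerProduct.
Context (R : realType) (H : completeNormedModType R)
  (ip : {dot H for (@idfun R)}) (ip_norm : inner_product_of_norm ip).

Lemma dotC (u v : H) : ip u v = ip v u.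
Proof. by rewrite hermC expr0 mul1r. Qed.

Lemma dotDl (u v w : H) : ip (u + v) w = ip u w + ip v w.
Proof. exact: linearDl. Qed.

Lemma dotDr (u v w : H) : ip u (v + w) = ip u v + ip u w.
Proof. exact: linearDr. Qed.

Lemma dotBl (u v w : H) : ip (u - v) w = ip u w - ip v w.
Proof. exact: linearBl. Qed.

Lemma dotBr (u v w : H) : ip u (v - w) = ip u v - ip u w.
Proof. exact: linearBr. Qed.

Lemma dotZl a (u v : H) : ip (a *: u) v = a * ip u v.
Proof. exact: linearZl_LR. Qed.

Lemma dotZr a (u v : H) : ip u (a *: v) = a * ip u v.
Proof. by rewrite dotC dotZl dotC. Qed.

Lemma sqr_normD (u v : H) : `|u + v| ^+ 2 = `|u| ^+ 2 + 2 * ip u v + `|v| ^+ 2.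
Proof. by rewrite -!ip_norm dotDl !dotDr (dotC v u); lra. Qed.

Lemma sqr_normB (u v : H) : `|u - v| ^+ 2 = `|u| ^+ 2 - 2 * ip u v + `|v| ^+ 2.
Proof. by rewrite -!ip_norm dotBl !dotBr (dotC v u); lra. Qed.

(** Polarization writes [ip] through squared norms, so continuity of the norm suffices. *)
Lemma cvg_dot (T : Type) (F : set_system T) (FF : Filter F) (u v : T -> H)
    (a b : H) :
  u @ F --> a -> v @ F --> b -> ip (u t) (v t) @[t --> F] --> ip a b.
Proof.
move=> ua vb.
have pol (x y : H) :
    ip x y = 2^-1 * (`|x + y| ^+ 2 - `|x| ^+ 2 - `|y| ^+ 2).
  by rewrite sqr_normD; lra.
under eq_fun do rewrite pol expr2 (expr2 `|u _|) (expr2 `|v _|).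
rewrite pol expr2 (expr2 `|a|) (expr2 `|b|).
apply: cvgM; first exact: cvg_cst.
apply: cvgB; [apply: cvgB|].
- by apply: cvgM; apply: cvg_norm; apply: cvgD.
- by apply: cvgM; apply: cvg_norm.
- by apply: cvgM; apply: cvg_norm.
Qed.

Lemma dot_eq0_of_le (u : H) (a : R) :
  (forall s : R, s * a <= s ^+ 2 * `|u| ^+ 2) -> a = 0.
Proof.
move=> Hs; apply/eqP; apply: contraT => a0.
have p0 : 0 < `|u| ^+ 2 + 1 by rewrite ltr_pwDr // sqr_ge0.
(* With this value [y] of [s], [y * a] equals [y ^+ 2 * (|u| ^+ 2 + 1)], which exceeds the allowed
   bound by [y ^+ 2]. *)
have := Hs (a / (`|u| ^+ 2 + 1)).
set y := a / _ => Hy.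
have ay : a = y * (`|u| ^+ 2 + 1) by rewrite /y divfK // gt_eqF.
have : 0 < y ^+ 2 by rewrite exprn_even_gt0 //= mulf_neq0 // invr_eq0 gt_eqF.
by move: Hy; rewrite {1}ay; lra.
Qed.

(* The representative is the minimiser of [`|u| ^+ 2 - 2 * l u], whose
   minimising sequences are Cauchy by the parallelogram identity. *)
Lemma riesz (l : {linear H -> R^o}) : continuous l ->
  exists g : H, forall h, l h = ip g h.
Proof.
move=> lc.
have [C C0 lC] : exists2 C : R, 0 < C & forall h, `|l h| <= C * `|h|.
  have /linear_boundedP := @continuous_linear_bounded _ _ _ 0 l (lc 0).
  by move=> /pinfty_ex_gt0[C C0 HC]; exists C.
have lZ k u : l (k *: u) = k * l u by exact: linearZ.
have lD u v : l (u + v) = l u + l v by exact: linearD.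
pose J (u : H) : R := `|u| ^+ 2 - 2 * l u.
have Jlb u : - C ^+ 2 <= J u.
  have := lC u; rewrite ler_norml /J => /andP[_ h].
  have := sqr_ge0 (`|u| - C); rewrite sqrrB; lra.
have hasJ : has_inf (range J).
  by split; [exists (J 0), 0|exists (- C ^+ 2) => _ [u _ <-]; exact: Jlb].
pose m := inf (range J).
have mJ u : m <= J u by apply: ge_inf; [exact: hasJ.2|exists u].
have [w Jw] : {w : nat -> H & forall n, J (w n) < m + n.+1%:R^-1}.
  apply: (@choice _ _ (fun n u => J u < m + n.+1%:R^-1)) => n.
  have n0 : 0 < n.+1%:R^-1 :> R by rewrite invr_gt0 ltr0n.
  by have [_ [u _ <-] uP] := inf_adherent n0 hasJ; exists u.
(* The linear part of [J] cancels against the midpoint term, so two near-minimisers must be close to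
   each other. *)
have par u v : `|u - v| ^+ 2 = 2 * (J u + J v - 2 * J (2^-1 *: (u + v))).
  rewrite /J normrZ exprMn ger0_norm ?invr_ge0 // lZ lD.
  by rewrite sqr_normB sqr_normD; field.
have wd i j : `|w i - w j| ^+ 2 <= 2 * (i.+1%:R^-1 + j.+1%:R^-1).
  rewrite par; have := mJ (2^-1 *: (w i + w j)).
  have := Jw i; have := Jw j.
  move: (i.+1%:R^-1) (j.+1%:R^-1) (J _) (J _) (J _) => a b c d e; lra.
have wc : cvg (w @ \oo).
  apply: cauchy_cvg; apply: cauchy_exP => e e0.
  have e4 : 0 < e ^+ 2 / 4 by rewrite divr_gt0 // exprn_gt0.
  have [N _ NP] := near_infty_natSinv_lt (PosNum e4).
  exists (w N); exists N => // n /= Nn.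
  rewrite -ball_normE /= -(@ltr_pXn2r _ 2) ?nnegrE ?(ltW e0) //.
  have := wd N n; have := NP N (leqnn N); have := NP n Nn => /=.
  move: (N.+1%:R^-1) (n.+1%:R^-1) (`|_| ^+ 2) => a b c; lra.
pose g : H := lim (w @ \oo).
have Jg : J g = m.
  have Jcvg : J (w n) @[n --> \oo] --> J g.
    rewrite /J; under eq_fun do rewrite expr2.
    rewrite expr2; apply: cvgB.
      by apply: cvgM; apply: cvg_norm.
    by apply: cvgM; [exact: cvg_cst|exact: continuous_cvg (lc _) wc].
  apply/eqP; rewrite eq_le mJ andbT.
  have -> : m = lim (m + (n.+1%:R^-1 : R) @[n --> \oo]).
    apply/esym/cvg_lim => //; rewrite -[X in _ --> X]addr0.
    by apply: cvgD; [exact: cvg_cst|exact: cvg_harmonic].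
  have /cvg_lim <- := Jcvg => //.
  apply: ler_lim.
  - by apply/cvg_ex; exists (J g).
  - apply/cvg_ex; exists (m + 0).
    by apply: cvgD; [exact: cvg_cst|exact: cvg_harmonic].
  - by near=> n; apply/ltW/Jw.
(* First-order optimality: [J] at [g + s *: h] is at least [J g] for every [s] of either sign. *)
exists g => h.
suff : 2 * (l h - ip g h) = 0 by lra.
apply: (@dot_eq0_of_le h) => s.
have := mJ (g + s *: h); rewrite -Jg /J lD lZ sqr_normD.
rewrite normrZ exprMn -normrX ger0_norm ?sqr_ge0 // dotZr; lra.
Unshelve. all: by end_near. Qed.

End InnerProduct.

(** * Right difference quotients and monotonicity *)

(* [l] bounds the upper right Dini derivative of [G] at [t]. *)
Definition upper_slope (R : realType) (G : R -> R) (t l : R) : Prop :=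
  exists2 q : R -> R, q s @[s --> t^'+] --> l &
    \forall s \near t^'+, diff_quotient G t s <= q s.

Section Slopes.
Context (R : realType).
Implicit Types (F G : R -> R) (a t l : R).

Lemma upper_slope_cvg G t l :
  diff_quotient G t s @[s --> t^'+] --> l -> upper_slope G t l.
Proof.
by move=> Gl; exists (diff_quotient G t) => //; near=> s.
Unshelve. all: by end_near. Qed.

Lemma upper_slopeD F G t k l : upper_slope F t k -> upper_slope G t l ->
  upper_slope (fun s => F s + G s) t (k + l).
Proof.
move=> [p pk Fp] [q ql Gq]; exists (fun s => p s + q s); first exact: cvgD.
near=> s; rewrite (_ : diff_quotient _ t s =
  diff_quotient F t s + diff_quotient G t s).
  by apply: lerD; near: s.
by rewrite /diff_quotient -scalerDr; congr (_ *: _); rewrite opprD addrACA.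
Unshelve. all: by end_near. Qed.

Lemma upper_slopeZ_cvg G t l (c : R) :
  diff_quotient G t s @[s --> t^'+] --> l ->
  upper_slope (fun s => c * G s) t (c * l).
Proof.
move=> Gl; apply: upper_slope_cvg.
rewrite (_ : diff_quotient _ t = fun s => c * diff_quotient G t s).
  by apply: cvgM => //; exact: cvg_cst.
by apply/funext => s; rewrite /diff_quotient /GRing.scale /=; ring.
Qed.

(* At a minimum over [[s, t]] of [G r - e * r] other than the right endpoint,
   the upper slope would be at least [e]. *)
Lemma upper_slope_nonincreasing G s t : continuous G -> s <= t ->
  (forall r, s <= r -> r < t -> exists2 l, l <= 0 & upper_slope G r l) ->
  G t <= G s.
Proof.
move=> cG st slG.
apply/ler_addgt0Pr => e e0.
(* The summand 1 keeps the denominator positive when [s = t], and [d * (t - s) <= e] still holds. *)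
pose d := e / (t - s + 1).
have ts1 : 0 < t - s + 1 by rewrite ltr_wpDl // subr_ge0.
have d0 : 0 < d by rewrite divr_gt0.
pose K r := G r - d * r.
have cK : {within `[s, t], continuous K}.
  apply: continuous_subspaceT => r.
  apply: cvgB; first exact: cG.
  by apply: cvgM; [exact: cvg_cst|exact: cvg_id].
have [c cst Kc] := EVT_min st cK.
have ct : c = t.
  move: cst; rewrite in_itv /= => /andP[sc].
  rewrite le_eqVlt => /orP[/eqP//|ct].
  have [l l0 [q ql Gq]] := slG c sc ct.
  exfalso; near c^'+ => r.
  have cr : c < r by near: r; exact: nbhs_right_gt.
  have rt : r < t by near: r; exact: nbhs_right_lt.
  have qr : q r < d.
    by near: r; apply: (cvgr_lt _ ql); exact: le_lt_trans d0.
  have Gr : (r - c)^-1 *: (G r - G c) <= q r by near: r.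
  have := Kc r.
  rewrite in_itv /= (ltW (le_lt_trans sc cr)) (ltW rt) => /(_ isT).
  have : (r - c)^-1 *: (G r - G c) < d by exact: le_lt_trans qr.
  by rewrite /GRing.scale /= mulrC ltr_pdivrMr ?subr_gt0 // /K; lra.
have := Kc s; rewrite ct in_itv /= lexx st => /(_ isT).
suff : d * (t - s) <= e by rewrite /K; lra.
rewrite /d mulrAC ler_pdivrMr // ler_pM2l //; lra.
Unshelve. all: by end_near. Qed.

Lemma diff_quotient_id t :
  diff_quotient (fun s : R => s) t s @[s --> t^'+] --> (1 : R).
Proof.
apply: cvg_near_cst; near=> s.
rewrite /diff_quotient -[_ *: _]/(_ * _) mulVf // subr_eq0 gt_eqF.
  by [].
by near: s; exact: nbhs_right_gt.
Unshelve. all: by end_near. Qed.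

Lemma right_derivative_of_derive1 F t l : derivable F t 1 -> derive1 F t = l ->
  diff_quotient F t s @[s --> t^'+] --> l.
Proof.
move=> dF <-; rewrite derive1E.
have Fk : h^-1 *: (F (h + t) - F t) @[h --> 0^'] --> 'D_1 F t.
  have /cvg_ex[k Fk] : cvg (h^-1 *: (F (h%:A + t) - F t) @[h --> 0^']) := dF.
  rewrite (_ : (fun h => _) = (fun h : R => h^-1 *: (F (h%:A + t) - F t))).
    by rewrite (_ : 'D_1 F t = k) //; exact: cvg_lim.
  by apply/funext => h; rewrite /GRing.scale /= mulr1.
rewrite (_ : diff_quotient F t =
    (fun h => h^-1 *: (F (h + t) - F t)) \o (fun s => s - t)); last first.
  by apply/funext => s; rewrite /diff_quotient /= subrK.
apply: cvg_comp Fk.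
move=> A [e e0 eA]; exists e => //= s; rewrite /= distrC => se ts.
by apply: eA; rewrite /= ?sub0r ?normrN // subr_eq0 gt_eqF.
Qed.

End Slopes.

(** Trades finiteness of an integral for boundedness of a continuous nondecreasing function, which
    can be added to an energy and handled through slopes. *)
Lemma ge0_primitive (R : realType) (g : R -> R) (a : R) :
  continuous g -> (forall t, 0 <= g t) ->
  exists F : R -> R, [/\ continuous F, forall t, 0 <= F t,
    {homo F : s t / s <= t},
    forall t, a <= t -> diff_quotient F t s @[s --> t^'+] --> g t &
    (\int[lebesgue_measure]_(t in `[a, +oo[) (g t)%:E < +oo)%E <->
      has_ubound (range F)].
Proof.
move=> cg g0.
(* Integration starts at [a - 1] so that [a] is an interior point, where the fundamental theorem
   gives a two-sided derivative. *)
pose F0 x : R := (\int[lebesgue_measure]_(t in `[(a - 1), x]) g t)%R.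
have dF0 t : a - 1 < t -> derivable F0 t 1 /\ derive1 F0 t = g t.
  move=> at_; apply: (@continuous_FTC1_closed _ g (a - 1) t (t + 1)) => //.
  - by rewrite ltrDl.
  - apply: continuous_compact_integrable; first exact: segment_compact.
    exact: continuous_subspaceT.
  - exact: cg.
have cF0 t : a <= t -> {for t, continuous F0}.
  move=> at_; apply: differentiable_continuous; apply/derivable1_diffP.
  by apply: (dF0 _ _).1; lra.
(* Freezing the primitive to the left of [a] makes it continuous and monotone on the whole line. *)
pose F t := F0 (Num.max t a).
have FE t : a <= t -> F t = F0 t by move=> at_; rewrite /F max_l.
have cF : continuous F.
  move=> t; apply: (@continuous_comp _ _ _ (Num.max^~ a) F0).
    exact: continuous_max (@cvg_id _ _) (cvg_cst _).
  by apply: cF0; rewrite le_max lexx orbT.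
have dF t : a <= t -> diff_quotient F t s @[s --> t^'+] --> g t.
  move=> at_; have [|dt et] := dF0 t; first by lra.
  have := right_derivative_of_derive1 dt et.
  apply: cvg_trans; apply: near_eq_cvg; near=> s.
  have ts : t < s by near: s; exact: nbhs_right_gt.
  by rewrite /diff_quotient !FE // (le_trans at_) // ltW.
have Fm s t : a <= s -> s <= t -> F s <= F t.
  move=> as_ st; rewrite -lerN2 -(mulN1r (F t)) -(mulN1r (F s)).
  apply: (@upper_slope_nonincreasing _ (fun t => -1 * F t)) => //.
    by move=> r; apply: cvgM; [exact: cvg_cst|exact: cF].
  move=> r sr _; exists (-1 * g r); first by rewrite mulN1r oppr_le0.
  by apply: upper_slopeZ_cvg; apply: dF; exact: le_trans sr.
have Fmax t : F t = F (Num.max t a) by rewrite /F -maxA maxxx.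
have F_ge0 t : 0 <= F t by apply: Rintegral_ge0 => s _; exact: g0.
have Fhomo : {homo F : s t / s <= t}.
  move=> s t st; rewrite (Fmax s) (Fmax t); apply: Fm.
    by rewrite le_max lexx orbT.
  by rewrite ge_max !le_max st lexx orbT.
exists F; split => //; split.
- move=> intg.
  exists (F a + fine (\int[lebesgue_measure]_(t in `[a, +oo[) (g t)%:E)%E).
  move=> _ [t _ <-].
  have I0 : (0 <= \int[lebesgue_measure]_(t in `[a, +oo[) (g t)%:E)%E.
    by apply: integral_ge0 => s _; rewrite lee_fin.
  have [at_|ta] := ltP a t; last first.
    apply: (@le_trans _ _ (F a)); first exact: Fhomo.
    by rewrite lerDl fine_ge0.
  rewrite -lerBlDl -lee_fin fineK; last by rewrite ge0_fin_numE.
  rewrite EFinB !FE ?(ltW at_) // -(@continuous_FTC2 _ g F0) //.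
  + apply: ge0_subset_integral => //.
    * apply/measurable_EFinP; apply: measurable_funTS.
      exact: continuous_measurable_fun.
    * by move=> s _; rewrite lee_fin.
    * by apply: subset_itvl; rewrite bnd_simp.
  + exact: continuous_subspaceT.
  + split.
    * by move=> s; rewrite in_itv /= => /andP[s1 _]; apply: (dF0 _ _).1; lra.
    * by apply: cvg_at_right_filter; exact: cF0.
    * by apply: cvg_at_left_filter; apply: cF0; exact: ltW.
  + by move=> s; rewrite in_itv /= => /andP[s1 _]; apply: (dF0 _ _).2; lra.
(* A bounded nondecreasing [F] converges to its supremum, so the integral equals the finite number
   [sup (range F) - F0 a]. *)
- move=> Fub; rewrite (@ge0_continuous_FTC2y _ g F0 a (sup (range F))) //.
  + exact: ltry.
  + exact: continuous_subspaceT.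
  + apply: cvg_trans (nondecreasing_cvgr Fhomo Fub).
    apply: near_eq_cvg; near=> s; apply: FE.
    by near: s; apply: nbhs_pinfty_ge; exact: num_real.
  + by move=> t at_; apply: (dF0 _ _).1; lra.
  + by apply: cvg_at_right_filter; exact: cF0.
  + by move=> s; rewrite in_itv /= andbT => s1; apply: (dF0 _ _).2; lra.
Unshelve. all: by end_near. Qed.

(** * Gradients and smoothing functions *)

Section Smoothing.
Context (R : realType) (H : completeNormedModType R)
  (ip : {dot H for (@idfun R)}) (ip_norm : inner_product_of_norm ip).

(** The Riesz theorem makes the set in [grad] nonempty, so [get] picks a genuine representative. *)
Lemma gradE (f : H -> R) (x h : H) :
  differentiable f x -> 'd f x h = ip (grad ip f x) h.
Proof.
move=> df; rewrite /grad; case: xgetP => [g _ -> //|nograd].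
have [g gE] := riesz ip_norm (diff_continuous df).
by have := nograd g; rewrite /= => /(_ gE).
Qed.

(** The directional derivative is a limit of right difference quotients, and convexity bounds each
    of them by [f y - f x] for steps [s <= 1]. *)
Lemma convex_gradient_ineq (f : H -> R) (x y : H) :
  convex_function [set: convex_lmodType H] f -> differentiable f x ->
  ip (grad ip f x) (y - x) <= f y - f x.
Proof.
move=> cf df; rewrite -gradE // -deriveE //.
have cvD : derivable f x (y - x) by exact: diff_derivable.
rewrite /derive (cvg_at_rightE _ _ cvD).
apply: limr_le.
  by apply/cvg_ex; exists ('D_(y - x) f x); exact: cvg_dnbhs_at_right cvD.
near=> s.
have s0 : 0 < s by near: s; exact: nbhs_right_gt.
have s1 : s <= 1 by near: s; exact: nbhs_right_le.
have s01 : 0 <= s <= 1 by rewrite ltW.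
pose p : {i01 R} := Itv01 (ltW s0) s1.
have cfs : f (s *: y + (1 - s) *: x) <= s * f y + (1 - s) * f x.
  by have := cf p y x; rewrite !inE => /(_ I I).
rewrite /= -[_ *: (f _ - f _)]/(_ * (f _ - f _)).
rewrite mulrC ler_pdivrMr // mulrBl.
rewrite (_ : s *: (y - x) + x = s *: y + (1 - s) *: x).
  lra.
by rewrite scalerBr scalerBl scale1r addrAC addrA.
Unshelve. all: by end_near. Qed.

Context (f : H -> R) (ft : H -> R -> R)
  (smooth : smoothing_function ip f ft).

Context (kappa : R) (kappa_gt0 : 0 < kappa) (kappaP : forall (x : H) (mu : R),
  0 < mu -> `|derive1 (ft x) mu| <= kappa).

Lemma smoothing_lipschitz_mu x (mu nu : R) : 0 < mu -> mu <= nu ->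
  `|ft x nu - ft x mu| <= kappa * (nu - mu).
Proof.
move=> mu0 munu.
have d s : mu <= s -> derivable (ft x) s 1.
  by move=> mus; apply: (smoothing_derivable smooth); exact: lt_le_trans mus.
have [||c] := @MVT_segment _ (ft x) (derive1 (ft x)) mu nu munu.
- move=> s; rewrite in_itv /= => /andP[/ltW/d ds _].
  by rewrite derive1E; exact: derivableP.
- apply: derivable_within_continuous => s; rewrite in_itv /= => /andP[mus _].
  exact: d.
rewrite in_itv /= => /andP[muc _] ->; rewrite normrM.
rewrite (ger0_norm (_ : 0 <= nu - mu)) ?subr_ge0 // ler_wpM2r ?subr_ge0 //.
by apply: kappaP; exact: lt_le_trans muc.
Qed.

(** Compares the parameters [mu] and [nu] at fixed [x], then lets [nu] decrease to 0. *)
Lemma smoothing_approx x (mu : R) : 0 < mu -> `|ft x mu - f x| <= kappa * mu.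
Proof.
move=> mu0.
have ftf : ft x nu @[nu --> 0^'+] --> f x.
  apply: (@cvg_comp _ _ _ (fun nu => (x, nu)) (fun p => ft p.1 p.2)
    _ _ _ _ (smoothing_limit smooth (x := x))).
  move=> A [[P Q] [xP Q0] PQ]; apply: filterS Q0 => nu Qnu.
  by apply: PQ; split => //; exact: nbhs_singleton xP.
have lim_norm : `|ft x mu - ft x nu| @[nu --> 0^'+] --> `|ft x mu - f x|.
  by apply: cvg_norm; apply: cvgB => //; exact: cvg_cst.
rewrite -(cvg_lim _ lim_norm) //.
apply: limr_le; first by apply/cvg_ex; exists `|ft x mu - f x|.
near=> nu.
have nu0 : 0 < nu by near: nu; exact: nbhs_right_gt.
have numu : nu <= mu by near: nu; exact: nbhs_right_le.
apply: le_trans (smoothing_lipschitz_mu _ nu0 numu) _.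
by rewrite ler_wpM2l ?(ltW kappa_gt0) // gerBl ltW.
Unshelve. all: by end_near. Qed.

(** By [smoothing_approx], [f] is a uniform limit of the continuous functions [ft ^~ mu]. This later
    gives measurability of [f] along the trajectory. *)
Lemma smoothed_continuous : continuous f.
Proof.
move=> x; apply/cvgrPdist_lt => e e0.
pose mu := e / (3 * kappa).
have mu0 : 0 < mu by rewrite divr_gt0 // mulr_gt0.
have kmu : kappa * mu = e / 3.
  by rewrite /mu; field; rewrite gt_eqF.
have ct : {for x, continuous (ft ^~ mu)}.
  by apply: differentiable_continuous; exact: (smoothing_differentiable smooth).
near=> y.
have hy : `|ft x mu - ft y mu| < e / 3.
  by near: y; move/cvgrPdist_lt : ct; apply; rewrite divr_gt0.
have := smoothing_approx x mu0; have := smoothing_approx y mu0; rewrite kmu.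
move: hy; rewrite !ltr_norml !ler_norml => /andP[? ?] /andP[? ?] /andP[? ?].
by apply/andP; split; lra.
Unshelve. all: by end_near. Qed.

End Smoothing.

(** * Energy estimates *)

Section Energy.
Context (R : realType) (H : completeNormedModType R)
  (ip : {dot H for (@idfun R)}) (ip_norm : inner_product_of_norm ip)
  (f : H -> R) (ft : H -> R -> R) (smooth : smoothing_function ip f ft)
  (kappa : R) (kappa_gt0 : 0 < kappa) (kappaP : forall (x : H) (mu : R),
    0 < mu -> `|derive1 (ft x) mu| <= kappa)
  (xs : H) (xs_min : forall y, f xs <= f y)
  (alpha t0 : R) (t0_gt0 : 0 < t0) (X V A : R -> H) (M : R -> R)
  (cX : continuous X) (cV : continuous V) (cA : continuous A)
  (cM : continuous M) (M_gt0 : forall t, 0 < M t)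
  (M_decr : forall s t, s <= t -> M t <= M s)
  (X_deriv : forall t, t0 <= t -> diff_quotient X t s @[s --> t^'+] --> V t)
  (V_deriv : forall t, t0 <= t ->
    diff_quotient V t s @[s --> t^'+] --> - (alpha / t) *: V t - A t)
  (A_grad : forall t, t0 <= t -> A t = grad ip (ft ^~ (M t)) (X t)).

(* The shift by [kappa * M t] makes [gap] dominate [f (X t) - f xs], and makes
   its dependence on [M] monotone, so that its upper slope only involves the
   gradient in the first variable. *)
Definition gap t : R := ft (X t) (M t) + kappa * M t - f xs.

Lemma gap_ge t : f (X t) - f xs <= gap t.
Proof.
have := smoothing_approx smooth kappa_gt0 kappaP (X t) (M_gt0 t).
by rewrite ler_norml /gap => /andP[+ _]; lra.
Qed.

Lemma gap_ge0 t : 0 <= gap t.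
Proof. by apply: le_trans (gap_ge t); rewrite subr_ge0. Qed.

(** The increment is split at [ft (X s) (M t)]: first [X] moves with the parameter frozen, then [M]
    moves, at a cost uniform in the point. *)
Lemma gap_continuous : continuous gap.
Proof.
move=> t.
have cMt : {for t, continuous M} := cM (x := t).
suff cft : (ft (X s) (M s)) @[s --> t] --> ft (X t) (M t).
  apply: cvgB; last exact: cvg_cst.
  by apply: cvgD => //; apply: cvgM => //; exact: cvg_cst.
apply/cvgrPdist_lt => e e0.
have cXt : ft (X s) (M t) @[s --> t] --> ft (X t) (M t).
  apply: (@continuous_cvg _ _ _ _ _ X (ft ^~ (M t))); last exact: cX.
  apply: differentiable_continuous.
  exact: (smoothing_differentiable smooth).
near=> s.
have h1 : `|ft (X t) (M t) - ft (X s) (M t)| < e / 2.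
  by near: s; move/cvgrPdist_lt : cXt; apply; rewrite divr_gt0.
have h2 : `|M t - M s| < e / (2 * kappa).
  by near: s; move/cvgrPdist_lt : cMt; apply; rewrite divr_gt0 // mulr_gt0.
have h3 : `|ft (X s) (M t) - ft (X s) (M s)| <= kappa * `|M t - M s|.
  have [ts|st] := leP (M t) (M s).
    rewrite distrC (distrC (M t)) (ger0_norm (_ : 0 <= M s - M t)) ?subr_ge0 //.
    exact: (smoothing_lipschitz_mu smooth kappaP).
  rewrite (gtr0_norm (_ : 0 < M t - M s)) ?subr_gt0 //.
  by apply: (smoothing_lipschitz_mu smooth kappaP) => //; exact: ltW.
have h4 : kappa * `|M t - M s| < e / 2.
  have -> : e / 2 = kappa * (e / (2 * kappa)) by field; rewrite gt_eqF.
  by rewrite ltr_pM2l.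
rewrite -(subrKA (ft (X s) (M t))) (le_lt_trans (ler_normD _ _)) //; lra.
Unshelve. all: by end_near. Qed.

(** The gradient inequality is taken at the later point [X s] with parameter [M s]; passing from
    [M t] down to [M s] cannot increase the shifted value at [X t]. *)
Lemma gap_diff_quotient t s : t0 <= t -> t < s ->
  diff_quotient gap t s <= ip (A s) (diff_quotient X t s).
Proof.
move=> t0t ts; rewrite /diff_quotient dotZr -[_ *: _]/(_ * _).
rewrite ler_pM2l ?invr_gt0 ?subr_gt0 // A_grad; last first.
  exact: le_trans t0t (ltW ts).
have := convex_gradient_ineq ip_norm (X t)
  (smoothing_convex smooth (M_gt0 s))
  (smoothing_differentiable smooth (M_gt0 s) (X s)).
have := smoothing_lipschitz_mu smooth kappaP (X t) (M_gt0 s) (M_decr (ltW ts)).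
rewrite ler_norml => /andP[+ _]; rewrite -opprB !dotBr /gap; lra.
Qed.

Definition energy c t : R :=
  t ^+ 2 * gap t + 2^-1 * `|c *: (X t - xs) + t *: V t| ^+ 2.

Lemma energy_continuous c : continuous (energy c).
Proof.
move=> t; rewrite /energy.
have cw : c *: (X s - xs) + s *: V s @[s --> t] --> c *: (X t - xs) + t *: V t.
  apply: cvgD; last by apply: cvgZ; [exact: cvg_id|exact: cV].
  by apply: cvgZ; [exact: cvg_cst|apply: cvgB; [exact: cX|exact: cvg_cst]].
apply: cvgD; apply: cvgM.
- by under eq_fun do rewrite expr2; rewrite expr2; apply: cvgM; exact: cvg_id.
- exact: gap_continuous.
- exact: cvg_cst.
- by under eq_fun do rewrite expr2; rewrite expr2; apply: cvgM; exact: cvg_norm.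
Qed.

(** By the equation, [c *: (X t - xs) + t *: V t] has right derivative
    [(c + 1 - alpha) *: V t - t *: A t]. Its product with [t *: V t] cancels the term
    [t ^+ 2 * ip (A t) (V t)] coming from [gap]. *)
Lemma energy_upper_slope c t : t0 <= t -> upper_slope (energy c) t
  (2 * t * gap t + c * (c + 1 - alpha) * ip (X t - xs) (V t)
   + (c + 1 - alpha) * t * `|V t| ^+ 2 - c * t * ip (X t - xs) (A t)).
Proof.
move=> t0t; have t_gt0 : 0 < t by exact: lt_le_trans t0t.
have s_t : s @[s --> t^'+] --> t by apply: cvg_at_right_filter; exact: cvg_id.
pose w s : H := c *: (X s - xs) + s *: V s.
pose w' : H := (c + 1 - alpha) *: V t - t *: A t.
have dw : diff_quotient w t s @[s --> t^'+] --> w'.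
  have -> : w' = c *: V t + (V t + t *: (- (alpha / t) *: V t - A t)).
    rewrite /w' scalerBr scalerA (_ : t * - (alpha / t) = - alpha).
      by rewrite !scalerDl scale1r !addrA.
    by field; rewrite gt_eqF.
  have : c *: diff_quotient X t s + (V s + t *: diff_quotient V t s)
      @[s --> t^'+] --> c *: V t + (V t + t *: (- (alpha / t) *: V t - A t)).
    apply: cvgD; first by apply: cvgZ; [exact: cvg_cst|exact: X_deriv].
    apply: cvgD; first by apply: cvg_at_right_filter; exact: cV.
    by apply: cvgZ; [exact: cvg_cst|exact: V_deriv].
  apply: cvg_trans; apply: near_eq_cvg; near=> s.
  have ts : t < s by near: s; exact: nbhs_right_gt.
  have st : s - t != 0 by rewrite subr_eq0 gt_eqF.
  rewrite /diff_quotient /w.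
  have -> : c *: (X s - xs) + s *: V s - (c *: (X t - xs) + t *: V t) =
      c *: (X s - X t) + ((s - t) *: V s + t *: (V s - V t)).
    rewrite opprD addrACA -scalerBr opprB subrKA; congr (_ + _).
    by rewrite scalerBl scalerBr addrA subrK.
  by rewrite !scalerDr !scalerA mulVf // scale1r (mulrC c) (mulrC t).
have slw : upper_slope (fun s => 2^-1 * `|w s| ^+ 2) t (ip (w t) w').
  apply: upper_slope_cvg.
  (* A difference of squared norms is the inner product of the sum and the difference. *)
  rewrite (_ : diff_quotient _ t = fun s =>
      ip (2^-1 *: (w s + w t)) (diff_quotient w t s)); last first.
    apply/funext => s; rewrite /diff_quotient dotZl dotZr dotDl !dotBr.
    rewrite (dotC _ (w t)) -[_ *: (_ - _)]/(_ * (_ - _)) -!ip_norm; ring.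
  apply: (cvg_dot ip_norm) => //.
  have -> : nbhs (w t) = nbhs (2^-1 *: (w t + w t)).
    by rewrite scalerDr -scalerDl (_ : 2^-1 + 2^-1 = 1) ?scale1r //; field.
  apply: cvgZ; first exact: cvg_cst.
  apply: cvgD; last exact: cvg_cst.
  apply: cvg_at_right_filter; apply: cvgD.
    by apply: cvgZ; [exact: cvg_cst|apply: cvgB; [exact: cX|exact: cvg_cst]].
  by apply: cvgZ; [exact: cvg_id|exact: cV].
have slg : upper_slope (fun s => s ^+ 2 * gap s) t
    ((t + t) * gap t + t ^+ 2 * ip (A t) (V t)).
  exists (fun s => (s + t) * gap s + t ^+ 2 * ip (A s) (diff_quotient X t s)).
    apply: cvgD; apply: cvgM.
    - by apply: cvgD => //; exact: cvg_cst.
    - by apply: cvg_at_right_filter; exact: gap_continuous.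
    - exact: cvg_cst.
    - apply: (cvg_dot ip_norm); last exact: X_deriv.
      by apply: cvg_at_right_filter; exact: cA.
  near=> s.
  have ts : t < s by near: s; exact: nbhs_right_gt.
  have st : s - t != 0 by rewrite subr_eq0 gt_eqF.
  rewrite (_ : diff_quotient _ t s =
      (s + t) * gap s + t ^+ 2 * diff_quotient gap t s); last first.
    rewrite /diff_quotient -![_ *: (_ - _)]/(_ * (_ - _)); field.
    by [].
  rewrite lerD2l ler_wpM2l ?sqr_ge0 //; exact: gap_diff_quotient.
have := upper_slopeD slg slw; rewrite -/(energy c).
rewrite /w /w'; set y := X t - xs.
rewrite dotDl !dotZl !dotBr !dotZr -ip_norm (dotC _ (A t) (V t)).
congr (upper_slope _ t _); ring.
Unshelve. all: by end_near. Qed.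

(** The factor 2 collects the smoothing error at [xs] and the shift built into [gap], each worth
    [kappa * M t]. *)
Lemma gap_gradient_ineq t : t0 <= t ->
  - ip (X t - xs) (A t) <= 2 * kappa * M t - gap t.
Proof.
move=> t0t; have := convex_gradient_ineq ip_norm xs
  (smoothing_convex smooth (M_gt0 t))
  (smoothing_differentiable smooth (M_gt0 t) (X t)).
have := smoothing_approx smooth kappa_gt0 kappaP xs (M_gt0 t).
rewrite -A_grad // ler_norml => /andP[_].
by rewrite (dotC _ (X t - xs)) !dotBr /gap; lra.
Qed.

(** * Integrability and decay of the gap *)

Let max_continuous : continuous (fun t : R => Num.max t t0).
Proof. by move=> t; exact: continuous_max (@cvg_id _ _) (cvg_cst _). Qed.

Let max_ge0 t : 0 <= Num.max t t0.
Proof. by rewrite le_max (ltW t0_gt0) orbT. Qed.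

(** The weight [Num.max t t0] is [t] on the domain of integration and keeps the integrands
    nonnegative on the whole line, as [ge0_primitive] requires. *)
Let intM := (\int[lebesgue_measure]_(t in `[t0, +oo[)
  (Num.max t t0 * M t)%:E < +oo)%E.
Let intgap := (\int[lebesgue_measure]_(t in `[t0, +oo[)
  (Num.max t t0 * gap t)%:E < +oo)%E.
Let intV := (\int[lebesgue_measure]_(t in `[t0, +oo[)
  (Num.max t t0 * `|V t| ^+ 2)%:E < +oo)%E.

Let continuous_max_gap : continuous (fun t => Num.max t t0 * gap t).
Proof.
by move=> t; apply: cvgM; [exact: max_continuous|exact: gap_continuous].
Qed.

Let continuous_max_V : continuous (fun t => Num.max t t0 * `|V t| ^+ 2).
Proof.
move=> t; apply: cvgM; first exact: max_continuous.
under eq_fun do rewrite expr2.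
by rewrite expr2; apply: cvgM; apply: cvg_norm; exact: cV.
Qed.

Lemma energy_ge c t : t ^+ 2 * gap t <= energy c t.
Proof. by rewrite /energy lerDl mulr_ge0 // sqr_ge0. Qed.

Lemma gap_decay : 3 <= alpha -> intM ->
  (exists C, forall t, t0 <= t -> t ^+ 2 * gap t <= C) /\ (3 < alpha -> intgap).
Proof.
move=> alpha3.
have [||F3 [cF3 F3_ge0 _ dF3 ->]] :=
    @ge0_primitive _ (fun t => Num.max t t0 * M t) t0.
- by move=> t; apply: cvgM; [exact: max_continuous|exact: cM].
- by move=> t; rewrite mulr_ge0 // ltW.
have [||F1 [cF1 F1_ge0 F1m dF1 F1P]] :=
    @ge0_primitive _ (fun t => Num.max t t0 * gap t) t0.
- exact: continuous_max_gap.
- by move=> t; rewrite mulr_ge0 // gap_ge0.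
move=> [K KF3].
(* This is the coefficient of [t * M t] left after multiplying [gap_gradient_ineq] by
   [(alpha - 1) * t]. The primitives in [G] compensate both remaining terms of the slope of the
   energy. *)
pose k := 2 * (alpha - 1) * kappa.
pose G t := energy (alpha - 1) t + ((alpha - 3) * F1 t + (- k) * F3 t).
have G_le t : t0 <= t -> G t <= G t0.
  move=> t0t; apply: upper_slope_nonincreasing => //.
    move=> r; apply: cvgD; first exact: energy_continuous.
    by apply: cvgD; apply: cvgM; [exact: cvg_cst|exact: cF1
      |exact: cvg_cst|exact: cF3].
  move=> r t0r _; have r0 : 0 < r by exact: lt_le_trans t0r.
  eexists; last first.
    apply: upper_slopeD; first exact: energy_upper_slope.
    apply: upper_slopeD; apply: upper_slopeZ_cvg; first exact: dF1.
    exact: dF3.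
  rewrite max_l //.
  have : (alpha - 1) * r * - ip (X r - xs) (A r)
      <= (alpha - 1) * r * (2 * kappa * M r - gap r).
    by rewrite ler_wpM2l ?gap_gradient_ineq // mulr_ge0 ?(ltW r0) //; lra.
  by rewrite /k; lra.
pose C := G t0 + k * K.
have le_C t : t0 <= t -> energy (alpha - 1) t + (alpha - 3) * F1 t <= C.
  move=> t0t; have := G_le t t0t.
  have : k * F3 t <= k * K.
    apply: ler_wpM2l; last by apply: KF3; exists t.
    by rewrite /k mulr_ge0 ?(ltW kappa_gt0) //; lra.
  by rewrite /C /G; lra.
split.
  exists C => t t0t; have := le_C t t0t; have := energy_ge (alpha - 1) t.
  have : 0 <= (alpha - 3) * F1 t by rewrite mulr_ge0 // subr_ge0.
  lra.
move=> alpha3'; apply/F1P; exists (C / (alpha - 3)) => _ [t _ <-].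
have a3 : 0 < alpha - 3 by rewrite subr_gt0.
(* The energy estimate holds only from [t0] on; monotonicity of [F1] covers earlier times. *)
apply: (@le_trans _ _ (F1 (Num.max t t0))).
  by apply: F1m; rewrite le_max lexx.
rewrite ler_pdivlMr // mulrC.
have t0t : t0 <= Num.max t t0 by rewrite le_max lexx orbT.
have := le_C _ t0t; have := energy_ge (alpha - 1) (Num.max t t0).
have : 0 <= (Num.max t t0) ^+ 2 * gap (Num.max t t0).
  by rewrite mulr_ge0 ?gap_ge0 // sqr_ge0.
lra.
Qed.

Lemma gap_little_decay : 3 < alpha -> intgap ->
  intV /\ forall e, 0 < e -> exists T, forall t, T <= t -> t ^+ 2 * gap t <= e.
Proof.
move=> alpha3.
have [||F1 [cF1 F1_ge0 F1m dF1 ->]] :=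
    @ge0_primitive _ (fun t => Num.max t t0 * gap t) t0.
- exact: continuous_max_gap.
- by move=> t; rewrite mulr_ge0 // gap_ge0.
have [||F2 [cF2 F2_ge0 F2m dF2 F2P]] :=
    @ge0_primitive _ (fun t => Num.max t t0 * `|V t| ^+ 2) t0.
- exact: continuous_max_V.
- by move=> t; rewrite mulr_ge0 // sqr_ge0.
move=> [K KF1].
have energy0_ge0 t : 0 <= energy 0 t.
  by apply: le_trans (energy_ge 0 t); rewrite mulr_ge0 ?gap_ge0 // sqr_ge0.
(* For [c = 0] the two primitives cancel the upper slope of the energy exactly. *)
have G_le s t : t0 <= s -> s <= t ->
    energy 0 t + ((alpha - 1) * F2 t + (-2) * F1 t) <=
    energy 0 s + ((alpha - 1) * F2 s + (-2) * F1 s).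
  move=> t0s st.
  apply: (@upper_slope_nonincreasing _ (fun t =>
    energy 0 t + ((alpha - 1) * F2 t + (-2) * F1 t))) => //.
    move=> r; apply: cvgD; first exact: energy_continuous.
    by apply: cvgD; apply: cvgM; [exact: cvg_cst|exact: cF2
      |exact: cvg_cst|exact: cF1].
  move=> r sr _; have t0r := le_trans t0s sr.
  eexists; last first.
    apply: upper_slopeD; first exact: energy_upper_slope.
    apply: upper_slopeD; apply: upper_slopeZ_cvg; first exact: dF2.
    exact: dF1.
  by rewrite max_l //; lra.
have intV_ok : intV.
  apply/F2P; exists ((energy 0 t0 + (alpha - 1) * F2 t0 + 2 * K) / (alpha - 1)).
  move=> _ [t _ <-]; apply: (@le_trans _ _ (F2 (Num.max t t0))).
    by apply: F2m; rewrite le_max lexx.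
  have t0t : t0 <= Num.max t t0 by rewrite le_max lexx orbT.
  have a1 : 0 < alpha - 1 by lra.
  rewrite ler_pdivlMr // mulrC.
  have := G_le t0 _ (lexx _) t0t; have := energy0_ge0 (Num.max t t0).
  have : F1 (Num.max t t0) <= K by apply: KF1; exists (Num.max t t0).
  by have := F1_ge0 t0; lra.
split=> // e e0.
have [K2 KF2] := F2P.1 intV_ok.
(* From [t0] on, [F] is a primitive of [energy 0 t / t]. *)
pose F t := F1 t + 2^-1 * F2 t.
have Fm : {homo F : s t / s <= t}.
  by move=> s t st; rewrite /F lerD ?F1m // ler_wpM2l // F2m.
have hasF : has_sup (range F).
  split; first by exists (F 0), 0.
  exists (K + 2^-1 * K2) => _ [t _ <-]; rewrite /F lerD ?ler_wpM2l //.
  - by apply: KF1; exists t.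
  - by apply: KF2; exists t.
(* Budget: an energy below [e / 3] at some time [s], plus a later growth of at most twice a tail
   below [e / 6], stays below [e]. *)
have e6 : 0 < e / 6 by rewrite divr_gt0.
have [_ [T1 _ <-] T1P] := sup_adherent e6 hasF.
pose T := Num.max T1 t0.
have t0T : t0 <= T by rewrite le_max lexx orbT.
have T0 : 0 < T by exact: lt_le_trans t0T.
have tail t : F t - F T < e / 6.
  have : F t <= sup (range F) by apply: sup_upper_bound => //; exists t.
  have : F T1 <= F T by apply: Fm; rewrite le_max lexx.
  lra.
(* Otherwise [t * (gap t + `|V t| ^+ 2 / 2)], which is [energy 0 t / t], would
   be at least [e / (6 * T)] on all of [[T, 2 * T]]. *)
have [s [Ts sE]] : exists s, T <= s /\ energy 0 s < e / 3.
  apply: contrapT => noS.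
  have big s : T <= s -> e / 3 <= energy 0 s.
    by move=> Ts; rewrite leNgt; apply/negP => sE; apply: noS; exists s.
  have T2 : T <= 2 * T by lra.
  have : e / (6 * T) * (2 * T) + ((-1) * F1 (2 * T) + (- 2^-1) * F2 (2 * T)) <=
      e / (6 * T) * T + ((-1) * F1 T + (- 2^-1) * F2 T).
    apply: (@upper_slope_nonincreasing _ (fun t =>
      e / (6 * T) * t + ((-1) * F1 t + (- 2^-1) * F2 t))) => //.
      move=> r; apply: cvgD; first by
        apply: cvgM; [exact: cvg_cst|exact: cvg_id].
      by apply: cvgD; apply: cvgM; [exact: cvg_cst|exact: cF1
        |exact: cvg_cst|exact: cF2].
    move=> r Tr r2T; have t0r := le_trans t0T Tr.
    have r0 : 0 < r by exact: lt_le_trans T0 Tr.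
    eexists; last first.
      apply: upper_slopeD.
        apply: (@upper_slopeZ_cvg _ (fun t => t)).
        exact: diff_quotient_id.
      apply: upper_slopeD; apply: upper_slopeZ_cvg; first exact: dF1.
      exact: dF2.
    rewrite max_l // mulr1.
    have := big r Tr.
    rewrite /energy scale0r add0r normrZ (gtr0_norm r0) exprMn.
    move=> Er.
    have -> : e / (6 * T) = e / 3 / (2 * T) by field; rewrite gt_eqF.
    have : e / 3 / (2 * T) <= e / 3 / r.
      rewrite ler_wpM2l ?divr_ge0 ?(ltW e0) // lef_pV2 ?posrE ?mulr_gt0 //.
      exact: ltW.
    have : e / 3 / r <= r * gap r + 2^-1 * (r * `|V r| ^+ 2).
      by rewrite ler_pdivrMr //; lra.
    lra.
  (* Over an interval of length [T] the lower bound makes [F] grow by at least [e / 6], against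
     [tail]. *)
  have -> : e / (6 * T) * (2 * T) = e / 3 by field; rewrite gt_eqF.
  have -> : e / (6 * T) * T = e / 6 by field; rewrite gt_eqF.
  by have := tail (2 * T); rewrite /F; lra.
exists s => t st.
have := G_le s t (le_trans t0T Ts) st; have := energy_ge 0 t.
have : F1 t - F1 s <= F t - F T.
  have := F2m s t st; have := Fm T s Ts; rewrite /F; lra.
have : (alpha - 1) * F2 s <= (alpha - 1) * F2 t.
  by rewrite ler_wpM2l ?F2m //; lra.
have := tail t; lra.
Qed.

End Energy.

(** * Functions on a half-line *)

Section HalfLine.
Context (R : realType) (V : normedModType R) (a : R).
Implicit Types u : R -> V.

(** Away from [t], [u s] is [u t] plus [s - t] times a convergent quotient; the point [s = t],
    missing from the punctured filter, is treated separately. *)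
Lemma derivable_within_continuous_at (A : set R) u t :
  derivable_within A u t -> u s @[s --> within A (nbhs t)] --> u t.
Proof.
move=> /cvg_ex[l ul].
have h : u t + (s - t) *: diff_quotient u t s @[s --> within A t^'] --> u t.
  rewrite -[X in _ --> X]addr0; apply: cvgD; first exact: cvg_cst.
  rewrite -(scale0r l); apply: cvgZ => //.
  rewrite -(subrr t); apply: cvgB; last exact: cvg_cst.
  do 2 apply: cvg_within_filter; exact: cvg_id.
apply/cvgrPdist_lt => e e0.
have : \forall s \near nbhs t, s != t -> A s ->
    `|u t - (u t + (s - t) *: diff_quotient u t s)| < e.
  by move/cvgrPdist_lt : h => /(_ e e0).
apply: filterS => s us As.
have [->|st] := eqVneq s t; first by rewrite subrr normr0.
have := us st As; rewrite /diff_quotient scalerA divff ?subr_eq0 // scale1r.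
by rewrite [_ + (_ - _)]addrC subrK.
Qed.

(** Points to the right of [t >= a] stay in the half-line, so the right-hand filter refines the
    punctured one. *)
Lemma diff_quotient_right u t : a <= t -> derivable_within `[a, +oo[ u t ->
  diff_quotient u t s @[s --> t^'+] --> derive_within `[a, +oo[ u t.
Proof.
move=> at_ du; apply: cvg_trans du.
apply: cvg_app => P.
move=> WP0; have WP :
    \forall s \near nbhs t, s != t -> `[a, +oo[%classic s -> P s := WP0.
suff : \forall s \near nbhs t, t < s -> P s by [].
apply: filterS WP => s Ps ts.
by apply: Ps; rewrite /= ?gt_eqF // in_itv /= andbT (le_trans at_) // ltW.
Qed.

Lemma continuous_max_extension u : {within `[a, +oo[, continuous u} ->
  continuous (fun t => u (Num.max t a)).
Proof.
move=> /subspace_continuousP cu t.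
have at_ : `[a, +oo[%classic (Num.max t a).
  by rewrite /= in_itv /= andbT le_max lexx orbT.
have cmax : Num.max s a @[s --> t] --> Num.max t a.
  exact: continuous_max (@cvg_id _ _) (cvg_cst _).
apply: (@cvg_comp _ _ _ (Num.max^~ a) u _ _ _ _ (cu _ at_)) => P WP.
have : \forall s \near t, `[a, +oo[%classic (Num.max s a) -> P (Num.max s a).
  exact: (cmax (fun y => `[a, +oo[%classic y -> P y)) WP.
apply: filterS => s; apply.
by rewrite /= in_itv /= andbT le_max lexx orbT.
Qed.

Lemma C1_within_continuous (A : set R) u :
  C1_within A u -> {within A, continuous u}.
Proof.
move=> [du _]; apply/subspace_continuousP => t At.
by apply: derivable_within_continuous_at; exact: du.
Qed.

End HalfLine.

(** * Extension of the trajectory to the whole line and transfer of the estimates *)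

Theorem theorem3p1 (R : realType) (H : completeNormedModType R)
    (ip : {dot H for (@idfun R)}) (ip_norm : inner_product_of_norm ip)
    (f : H -> R) (f_convex : convex_function [set: convex_lmodType H] f)
    (argmin_neq0 : argmin f !=set0)
    (ft : H -> R -> R) (ft_smoothing : smoothing_function ip f ft)
    (alpha t0 : R) (alpha_gt0 : 0 < alpha) (t0_gt0 : 0 < t0)
    (mu : R -> R) (mu_ge0 : forall t : R, 0 <= t -> 0 <= mu t)
    (mu_C1 : C1_within `[0, +oo[ mu)
    (mu_decr : forall s t : R, 0 <= s -> s < t -> mu t < mu s)
    (mu_lim : mu t @[t --> +oo] --> 0)
    (mu_int : (\int[lebesgue_measure]_(t in `[t0, +oo[) (t * mu t)%:E < +oo)%E)
    (x : R -> H) (x_traj : trajectory ip ft alpha t0 mu x) :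
  (3 <= alpha ->
     (fun t : R => f (x t) - min_value f) =O_+oo (fun t : R => t ^- 2))
  /\
  (3 < alpha ->
     [/\ (\int[lebesgue_measure]_(t in `[t0, +oo[)
            (t * (f (x t) - min_value f))%:E < +oo)%E,
         (\int[lebesgue_measure]_(t in `[t0, +oo[)
            (t * `|derive_within `[t0, +oo[ x t| ^+ 2)%:E < +oo)%E &
         (fun t : R => f (x t) - min_value f) =o_+oo (fun t : R => t ^- 2)]).
Proof.
pose v := derive_within `[t0, +oo[ x; pose v' := derive_within `[t0, +oo[ v.
(* All functions are frozen before [t0], which makes them continuous on the line without changing
   right derivatives from [t0] on. [A] is the gradient term solved from the equation. *)
pose X t := x (Num.max t t0); pose V t := v (Num.max t t0).
pose A t := - v' (Num.max t t0) - (alpha / Num.max t t0) *: V t.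
pose M t := mu (Num.max t t0); pose xs := get (argmin f).
have [kappa kappa0 kappaP] := smoothing_derive_bounded ft_smoothing.
have xs_min y : f xs <= f y.
  by have [z zmin] := argmin_neq0; exact: (@getPex _ (argmin f) argmin_neq0).
have maxE t : t0 <= t -> Num.max t t0 = t by move=> /max_l.
have max_ge t : t0 <= Num.max t t0 by rewrite le_max lexx orbT.
have max_gt0 t : 0 < Num.max t t0 by exact: lt_le_trans (max_ge t).
have [xC1 vC1 ode] := x_traj.
have cX : continuous X by exact/continuous_max_extension/C1_within_continuous.
have cV : continuous V by exact/continuous_max_extension/C1_within_continuous.
have cA : continuous A.
  move=> t; apply: cvgB; first by
    apply: cvgN; exact: continuous_max_extension vC1.2 t.
  apply: cvgZ; last exact: cV.
  apply: cvgM; first exact: cvg_cst.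
  apply: cvgV; first by rewrite gt_eqF.
  exact: continuous_max (@cvg_id _ _) (cvg_cst _).
have cM : continuous M.
  have -> : M = (fun t => mu (Num.max t 0)) \o (fun t => Num.max t t0).
    by apply/funext => t; rewrite /M /= [Num.max _ 0]max_l // ltW.
  move=> t; apply: continuous_comp.
    exact: continuous_max (@cvg_id _ _) (cvg_cst _).
  exact/continuous_max_extension/C1_within_continuous.
have M_gt0 t : 0 < M t.
  have max0 := ltW (max_gt0 t).
  (* One unit of time later [mu] is still nonnegative, so strict decrease makes it positive now. *)
  apply: le_lt_trans (mu_decr _ (Num.max t t0 + 1) max0 _).
    by apply: mu_ge0; rewrite addr_ge0.
  by rewrite ltrDl.
have M_decr s t : s <= t -> M t <= M s.
  move=> st; have : Num.max s t0 <= Num.max t t0.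
    by rewrite ge_max !le_max st lexx orbT.
  rewrite le_eqVlt /M => /orP[/eqP->//|st'].
  by apply/ltW/mu_decr => //; exact/ltW.
have right_ext (W : normedModType R) (u : R -> W) (l : W) t : t0 <= t ->
    diff_quotient u t s @[s --> t^'+] --> l ->
    diff_quotient (fun s => u (Num.max s t0)) t s @[s --> t^'+] --> l.
  move=> t0t; apply: cvg_trans; apply: near_eq_cvg; near=> s.
  rewrite /diff_quotient !maxE //; apply: le_trans t0t _.
  by near: s; exact: nbhs_right_ge.
have t0cy t : t0 <= t -> `[t0, +oo[%classic t by rewrite /= in_itv /= andbT.
have X_deriv t : t0 <= t -> diff_quotient X t s @[s --> t^'+] --> V t.
  move=> t0t; rewrite /V maxE //; apply: right_ext => //.
  by apply: diff_quotient_right => //; exact/xC1.1/t0cy.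
have V_deriv t : t0 <= t ->
    diff_quotient V t s @[s --> t^'+] --> - (alpha / t) *: V t - A t.
  move=> t0t; rewrite /A maxE // opprB scaleNr addrA addNr add0r opprK.
  apply: right_ext => //.
  by apply: diff_quotient_right => //; exact/vC1.1/t0cy.
have A_grad t : t0 <= t -> A t = grad ip (ft ^~ (M t)) (X t).
  move=> t0t; have := ode t t0t; rewrite -/v -/v' /A /V /M /X maxE //.
  by move/eqP; rewrite addrC addr_eq0 opprD => /eqP ->.
pose g := gap f ft kappa xs X M.
have g_ge t : t0 <= t -> `|f (x t) - min_value f| <= g t.
  move=> t0t; rewrite ger0_norm ?subr_ge0 ?xs_min //.
  by have := gap_ge ft_smoothing kappa0 kappaP xs X M_gt0 t; rewrite /X maxE.
have eq_int (h k : R -> R) : (forall t, t0 <= t -> h t = k t) ->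
    (\int[lebesgue_measure]_(t in `[t0, +oo[) (h t)%:E =
     \int[lebesgue_measure]_(t in `[t0, +oo[) (k t)%:E)%E.
  move=> hk; apply: eq_integral => t; rewrite inE /= in_itv /= andbT => t0t.
  by rewrite hk.
have intM : (\int[lebesgue_measure]_(t in `[t0, +oo[)
    (Num.max t t0 * M t)%:E < +oo)%E.
  rewrite (eq_int _ (fun t => t * mu t)) // => t t0t.
  by rewrite /M maxE.
have decay a3 := gap_decay ip_norm ft_smoothing kappa0 kappaP xs_min t0_gt0
  cX cV cA cM M_gt0 M_decr X_deriv V_deriv A_grad a3 intM.
have little_decay := gap_little_decay ip_norm ft_smoothing kappa0 kappaP xs_min
  t0_gt0 cX cV cA cM M_gt0 M_decr X_deriv V_deriv A_grad.
have t_pos t : t0 <= t -> 0 < t by exact: lt_le_trans.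
have norm_le t C : t0 <= t -> t ^+ 2 * g t <= C ->
    `|f (x t) - min_value f| <= C * `|t ^- 2|.
  move=> t0t gC; apply: le_trans (g_ge t t0t) _.
  rewrite ger0_norm ?invr_ge0 ?sqr_ge0 // ler_pdivlMr ?exprn_gt0 ?t_pos //.
  by rewrite mulrC.
split=> [alpha3|alpha3].
  have [[C gC] _] := decay alpha3.
  (* The Landau constant must be positive, which [C] alone need not be. *)
  apply/eqO_exP; exists (Num.max C 1); first by rewrite lt_max ltr01 orbT.
  near=> t; apply: norm_le; first by
    near: t; apply: nbhs_pinfty_ge; exact: num_real.
  apply: le_trans (gC t _) _; last by rewrite le_max lexx.
  by near: t; apply: nbhs_pinfty_ge; exact: num_real.
have intg := (decay (ltW alpha3)).2 alpha3.
have [intV little] := little_decay alpha3 intg.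
split.
- rewrite (eq_int _ (fun t => Num.max t t0 * (f (X t) - f xs))); last first.
    by move=> t t0t; rewrite /X maxE.
  have cmax : continuous (fun t => Num.max t t0).
    by move=> t; exact: continuous_max (@cvg_id _ _) (cvg_cst _).
  have cf := smoothed_continuous ft_smoothing kappa0 kappaP.
  have cg : continuous g :=
    gap_continuous ft_smoothing kappa0 kappaP cX cM M_gt0.
  have mEFin h : continuous h ->
      measurable_fun `[t0, +oo[%classic (fun t : R => (h t : R)%:E).
    move=> ch; apply/measurable_EFinP; apply: measurable_funTS.
    exact: continuous_measurable_fun.
  apply: le_lt_trans intg; apply: ge0_le_integral => //.
  + by move=> t _; rewrite lee_fin mulr_ge0 ?subr_ge0 // ltW.
  + apply: mEFin => t; apply: cvgM; first exact: cmax.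
    apply: cvgB; last exact: cvg_cst.
    apply: (@continuous_cvg _ _ _ _ _ X f); last exact: cX.
    exact: cf.
  + apply: mEFin => t; apply: cvgM; first exact: cmax.
    exact: cg.
  + move=> t _; rewrite lee_fin; apply: ler_wpM2l; first exact/ltW.
    exact: (gap_ge ft_smoothing kappa0 kappaP xs X M_gt0 t).
- rewrite (eq_int _ (fun t => Num.max t t0 * `|V t| ^+ 2)) // => t t0t.
  by rewrite /V maxE.
- apply/eqoP => e e0; have [T gT] := little e e0.
  near=> t; apply: norm_le; first by
    near: t; apply: nbhs_pinfty_ge; exact: num_real.
  by apply: gT; near: t; apply: nbhs_pinfty_ge; exact: num_real.
Unshelve. all: by end_near. Qed.
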